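(* Let $V$ be a unital JB-algebra with positive cone $\Omega$. The map $p\mapsto S_pG(\Omega)$, where $S_p=2L_p-\mathrm{Id}$, is a bijection from the set of central projections of $V$ onto the set of left cosets of $G(\Omega)$ in $\mathrm{Str}(V)$; that is, different central projections $p$ give different (disjoint) copies $S_pG(\Omega)$ of $G(\Omega)$ in $\mathrm{Str}(V)$, and all the copies $gG(\Omega)$, $g\in\mathrm{Str}(V)$, are obtained in this way.
   Context: A (unital) JB-algebra is a real Jordan algebra $(V,\circ)$ with unit $1$ (the product is bilinear, commutative and $x^2\circ(x\circ y)=x\circ(x^2\circ y)$) with a complete norm such that $\|x\circ y\|\le\|x\|\|y\|$, $\|x^2\|=\|x\|^2$, $\|x^2\|\le\|x^2+y^2\|$; it may be infinite dimensional. $GL(V)$ is the group of bounded invertible linear operators on $V$. $L_xy=x\circ y$, $U_x=2L_x^2-L_{x^2}$. An element $x$ is invertible if $U_x$ is an invertible operator, $\sigma(x)=\{\lambda\in\mathbb R: x-\lambda1\text{ not invertible}\}$, and $\Omega=\{x\in V:\sigma(x)\subset(0,+\infty)\}$. $G(\Omega)=\{g\in GL(V):g(\Omega)=\Omega\}$. The structure group $\mathrm{Str}(V)$ is the set of $g\in GL(V)$ for which there is $g^*\in GL(V)$ with $U_{gx}=gU_xg^*$ for all $x\in V$; one has $G(\Omega)\subset\mathrm{Str}(V)$. A central projection is $p\in V$ with $p^2=p$ and $L_pL_z=L_zL_p$ for all $z\in V$; for such $p$ one has $S_p\in\mathrm{Str}(V)$. *)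

(* Defs.v *)
From HB Require Import structures.
From mathcomp Require Import all_boot all_order all_algebra.
From mathcomp Require Import all_classical all_reals all_analysis.
Set Implicit Arguments.
Unset Strict Implicit.
Unset Printing Implicit Defensive.
Import Order.TTheory GRing.Theory Num.Theory.
Import numFieldNormedType.Exports.
Local Open Scope classical_set_scope.
Local Open Scope ring_scope.

HB.mixin Record Lmodule_isJordan (R : realType) V of GRing.Lmodule R V := {
  jmul : V -> V -> V;
  jone : V;
  jmulC : forall x y, jmul x y = jmul y x;
  jmul_linear : forall x, linear (jmul x);
  jmul1 : forall x, jmul jone x = x;
  jordan_identity : forall x y,
    jmul (jmul x x) (jmul x y) = jmul x (jmul (jmul x x) y)
}.

#[short(type="jordanAlgType")]
HB.structure Definition JordanAlgebra (R : realType) :=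
  {V of GRing.Lmodule R V & Lmodule_isJordan R V}.

HB.mixin Record CompleteJordan_isJB (R : realType) V
    of CompleteNormedModule R V & Lmodule_isJordan R V := {
  jb_normM : forall x y : V, `|jmul x y| <= `|x| * `|y|;
  jb_norm_sqr : forall x : V, `|jmul x x| = `|x| ^+ 2;
  jb_norm_sqrD : forall x y : V, `|jmul x x| <= `|jmul x x + jmul y y|
}.

#[short(type="jbAlgType")]
HB.structure Definition JBAlgebra (R : realType) :=
  {V of CompleteNormedModule R V & Lmodule_isJordan R V
      & CompleteJordan_isJB R V}.

Section JBAlgebraTheory.
Context {R : realType} {V : jbAlgType R}.
Implicit Types (x z p : V) (g h : V -> V).

Definition bounded_operator g : Prop :=
  linear g /\ exists M : R, forall x, `|g x| <= M * `|x|.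

(* The invertible elements of the algebra of bounded operators: the inverse is
   required to be bounded as well. *)
Definition GL : set (V -> V) :=
  [set g | bounded_operator g /\
     exists h, [/\ bounded_operator h, cancel g h & cancel h g]].

Definition jL x : V -> V := jmul x.

Definition jU x : V -> V := fun y => 2 *: jL x (jL x y) - jL (jmul x x) y.

Definition jinvertible x : Prop := GL (jU x).

Definition spectrum x : set R := [set l | ~ jinvertible (x - l *: jone)].

Definition Omega : set V := [set x | spectrum x `<=` [set l : R | 0 < l]].

Definition GOmega : set (V -> V) := [set g | GL g /\ g @` Omega = Omega].

Definition Str : set (V -> V) :=
  [set g | GL g /\
     exists2 gs, GL gs & forall x, jU (g x) = g \o jU x \o gs].

Definition central_projection : set V :=
  [set p | jmul p p = p /\ forall z, jL p \o jL z = jL z \o jL p].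

Definition jS p : V -> V := fun x => 2 *: jL p x - x.

Definition coset_GOmega g : set (V -> V) := [set g \o h | h in GOmega].

Definition Str_cosets : set (set (V -> V)) := [set coset_GOmega g | g in Str].

End JBAlgebraTheory.

Arguments Omega {R} V.
Arguments GOmega {R} V.
Arguments Str {R} V.
Arguments central_projection {R} V.
Arguments Str_cosets {R} V.
Arguments GL {R} V.

(* Main.v *)
(* Invertibility of y is preserved by g in Str(V), so g(Omega) is the set K of all
   y such that y + t a is invertible for every t >= 0, where a = g(1).  Omega
   consists of the x with |M 1 - x| < M for some M; it is an open convex cone,
   relatively closed in the invertible elements, and hence a may be replaced in
   the description of K by any other element of K.  The Newton-Schulz iteration
   started at a multiple of a stays in K and converges to some s in K with
   s^2 = 1.  If s x = 0, then (x + t s)^2 = x^2 + t^2 is invertible for t > 0, so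
   the line R x lies in the closure of the pointed cone K and x = 0.  Thus L_s is
   injective; L_s^3 = L_s gives L_s^2 = Id, and the polarised Jordan identity
   then makes s central.  Finally y + t s = s (s y + t 1) shows K = L_s(Omega),
   and p = (1 + s) / 2. *)
Require Import Defs.
From HB Require Import structures.
From mathcomp Require Import all_boot all_order all_algebra.
From mathcomp Require Import all_classical all_reals all_analysis.
From mathcomp Require Import ring lra.
Set Implicit Arguments.
Unset Strict Implicit.
Unset Printing Implicit Defensive.
Import Order.TTheory GRing.Theory Num.Theory.
Import numFieldNormedType.Exports.
Local Open Scope classical_set_scope.
Local Open Scope ring_scope.

(** * Linear identities in a module, decided by reflection *)

Section LinearCombinations.
Context {R : comNzRingType} {V : lmodType R}.

Inductive lincomb :=
  | LVar of nat | LZero | LAdd of lincomb & lincomb | LOpp of lincomb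
  | LScale of R & lincomb.

Fixpoint lin_eval (env : seq V) e : V :=
  match e with
  | LVar i => env`_i
  | LZero => 0
  | LAdd e1 e2 => lin_eval env e1 + lin_eval env e2
  | LOpp e1 => - lin_eval env e1
  | LScale c e1 => c *: lin_eval env e1
  end.

Fixpoint lin_coef e (i : nat) : R :=
  match e with
  | LVar j => (if Nat.eqb i j then 1 else 0)
  | LZero => 0
  | LAdd e1 e2 => lin_coef e1 i + lin_coef e2 i
  | LOpp e1 => - lin_coef e1 i
  | LScale c e1 => c * lin_coef e1 i
  end.

Fixpoint same_coefs n e1 e2 : Prop :=
  if n is n'.+1 then lin_coef e1 n' = lin_coef e2 n' /\ same_coefs n' e1 e2
  else True.

Lemma lin_evalE env e :
  lin_eval env e = \sum_(i < size env) lin_coef e i *: env`_i.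
Proof.
elim: e => [j||e1 IH1 e2 IH2|e1 IH1|c e1 IH1] /=.
- have [lt_j|le_j] := ltnP j (size env).
    rewrite (bigD1 (Ordinal lt_j)) //= PeanoNat.Nat.eqb_refl scale1r big1 ?addr0 //.
    move=> i ne; case: PeanoNat.Nat.eqb_spec; rewrite ?scale0r// => eq_ij.
    by case/eqP: ne; exact/val_inj.
  rewrite nth_default // big1 // => i _.
  case: PeanoNat.Nat.eqb_spec; rewrite ?scale0r// => eq_ij.
  by have := ltn_ord i; rewrite eq_ij ltnNge le_j.
- by rewrite big1 // => i _; rewrite scale0r.
- by rewrite IH1 IH2 -big_split; apply: eq_bigr => i _; rewrite scalerDl.
- by rewrite IH1 -sumrN; apply: eq_bigr => i _; rewrite scaleNr.
- by rewrite IH1 scaler_sumr; apply: eq_bigr => i _; rewrite scalerA.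
Qed.

Lemma lin_eval_eq env e1 e2 :
  same_coefs (size env) e1 e2 -> lin_eval env e1 = lin_eval env e2.
Proof.
rewrite !lin_evalE => same; apply: eq_bigr => i _; congr (_ *: _).
elim: (size env) same (i : nat) (ltn_ord i) => // n IHn [eq_n /IHn{}IHn] j.
by rewrite ltnS leq_eqVlt => /orP[/eqP ->|/IHn].
Qed.

End LinearCombinations.

Ltac lin_index x env :=
  lazymatch env with
  | x :: _ => constr:(O)
  | _ :: ?env' => let i := lin_index x env' in constr:(S i)
  end.
Ltac lin_mem x env :=
  lazymatch env with
  | x :: _ => constr:(true)
  | _ :: ?env' => lin_mem x env'
  | _ => constr:(false)
  end.
Ltac lin_atoms env t :=
  lazymatch t with
  | ?a + ?b => let env1 := lin_atoms env a in lin_atoms env1 b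
  | - ?a => lin_atoms env a
  | _ *: ?a => lin_atoms env a
  | 0 => env
  | _ => lazymatch lin_mem t env with
         | true => env
         | false => constr:(t :: env)
         end
  end.
Ltac lin_reify R env t :=
  lazymatch t with
  | ?a + ?b => let ea := lin_reify R env a in let eb := lin_reify R env b in
               constr:(LAdd ea eb)
  | - ?a => let ea := lin_reify R env a in constr:(LOpp ea)
  | ?c *: ?a => let ea := lin_reify R env a in constr:(@LScale R c ea)
  | 0 => constr:(@LZero R)
  | _ => let i := lin_index t env in constr:(@LVar R i)
  end.
(* Decides equality of linear combinations coefficientwise; field may leave
   non-vanishing side conditions on the coefficients. *)
Ltac lin R :=
  lazymatch goal with
  | |- @eq ?V ?a ?b =>
    let env := lin_atoms (@nil V) a in
    let env := lin_atoms env b in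
    let ea := lin_reify R env a in
    let eb := lin_reify R env b in
    apply: (@lin_eval_eq _ _ env ea eb);
    cbn [same_coefs size lin_coef Nat.eqb]; repeat split; field; try done
  end.

Section LinearMaps.
Context {R : realType} {V : lmodType R} (g : V -> V) (lin_g : linear g).

Lemma linear_addf u v : g (u + v) = g u + g v.
Proof. by have := lin_g 1 u v; rewrite !scale1r. Qed.
Lemma linear_0f : g 0 = 0.
Proof. by apply: (addrI (g 0)); rewrite -linear_addf !addr0. Qed.
Lemma linear_scalef c u : g (c *: u) = c *: g u.
Proof. by have := lin_g c u 0; rewrite linear_0f !addr0. Qed.
Lemma linear_oppf u : g (- u) = - g u.
Proof. by rewrite -scaleN1r linear_scalef scaleN1r. Qed.
Lemma linear_subf u v : g (u - v) = g u - g v.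
Proof. by rewrite linear_addf linear_oppf. Qed.

End LinearMaps.

(** * Jordan identities, power associativity and polynomial evaluation *)

Section JordanAlgebras.
Context {R : realType} {V : jbAlgType R}.
Implicit Types x y z w : V.
Implicit Types p q : {poly R}.
Local Notation "x ** y" := (jmul x y) (at level 40, left associativity).

Lemma jmulDr x y z : x ** (y + z) = x ** y + x ** z.
Proof. by have := jmul_linear x 1 y z; rewrite !scale1r. Qed.
Lemma jmulr0 x : x ** 0 = 0.
Proof. by apply: (addrI (x ** 0)); rewrite -jmulDr !addr0. Qed.
Lemma jmulZr c x y : x ** (c *: y) = c *: (x ** y).
Proof. by have := jmul_linear x c y 0; rewrite jmulr0 !addr0. Qed.
Lemma jmulNr x y : x ** (- y) = - (x ** y).
Proof. by rewrite -scaleN1r jmulZr scaleN1r. Qed.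
Lemma jmulDl x y z : (x + y) ** z = x ** z + y ** z.
Proof. by rewrite !(jmulC _ z) jmulDr. Qed.
Lemma jmulZl c x y : (c *: x) ** y = c *: (x ** y).
Proof. by rewrite !(jmulC _ y) jmulZr. Qed.
Lemma jmulNl x y : (- x) ** y = - (x ** y).
Proof. by rewrite !(jmulC _ y) jmulNr. Qed.
Lemma jmulr1 x : x ** jone = x.
Proof. by rewrite jmulC jmul1. Qed.

Definition jmulE :=
  (jmulDr, jmulDl, jmulNr, jmulNl, jmulZr, jmulZl, @jmul1 R V, jmulr1).

Lemma jordan_polarized x y z w :
  (x ** y) ** (z ** w) + (y ** z) ** (x ** w) + (z ** x) ** (y ** w) =
  x ** ((y ** z) ** w) + y ** ((z ** x) ** w) + z ** ((x ** y) ** w).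
Proof.
have F t : (t ** t) ** (t ** w) - t ** ((t ** t) ** w) = 0.
  by rewrite jordan_identity subrr.
apply/eqP; rewrite -subr_eq0; apply/eqP.
(* Inclusion-exclusion over the nonempty subsets of [{x, y, z}] isolates the trilinear part of the
   cubic [t^2 (t w) - t (t^2 w)], which is twice the wanted difference. *)
transitivity (2^-1 *: (((x + y + z) ** (x + y + z)) ** ((x + y + z) ** w)
   - (x + y + z) ** (((x + y + z) ** (x + y + z)) ** w)
   - (((x + y) ** (x + y)) ** ((x + y) ** w)
       - (x + y) ** (((x + y) ** (x + y)) ** w))
   - (((y + z) ** (y + z)) ** ((y + z) ** w)
       - (y + z) ** (((y + z) ** (y + z)) ** w))
   - (((x + z) ** (x + z)) ** ((x + z) ** w)
       - (x + z) ** (((x + z) ** (x + z)) ** w))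
   + (x ** x ** (x ** w) - x ** ((x ** x) ** w))
   + (y ** y ** (y ** w) - y ** ((y ** y) ** w))
   + (z ** z ** (z ** w) - z ** ((z ** z) ** w)))).
  rewrite !jmulE (jmulC y x) (jmulC z x) (jmulC z y).
  lin R.
by rewrite !F !subr0 !addr0 scaler0.
Qed.

(* The left-hand side of [jordan_polarized] is symmetric in all four variables;
   exchanging x and w on the right-hand side yields this identity. *)
Lemma jL_mul3 x y z w :
  ((y ** z) ** x) ** w =
  x ** ((y ** z) ** w) + y ** ((z ** x) ** w) + z ** ((x ** y) ** w)
  - y ** (x ** (z ** w)) - z ** (x ** (y ** w)).
Proof.
have exch : (x ** y) ** (z ** w) + (y ** z) ** (x ** w) + (z ** x) ** (y ** w) =
    ((y ** z) ** x) ** w + y ** (x ** (z ** w)) + z ** (x ** (y ** w)).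
  have := jordan_polarized w y z x.
  rewrite (jmulC w y) (jmulC w x) (jmulC z x) (jmulC w (_ ** x)) (jmulC (z ** w) x).
  rewrite (jmulC (y ** w) x) (jmulC y x) (jmulC (z ** w)) (jmulC (y ** w) (x ** z)).
  by move=> <-; lin R.
by rewrite -jordan_polarized exch; lin R.
Qed.


Lemma jL_cube y w :
  (y ** (y ** y)) ** w = 3 *: (y ** ((y ** y) ** w)) - 2 *: (y ** (y ** (y ** w))).
Proof. by rewrite (jmulC y (y ** y)) jL_mul3; lin R. Qed.

(** A case of the fundamental formula: by [jL_mul3], [L_{y^4}] is a polynomial in the commuting
    operators [L_y] and [L_{y^2}]. *)
Lemma jU_sqr y w : jU (y ** y) w = jU y (jU y w).
Proof.
have quad : ((y ** y) ** (y ** y)) ** w =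
    4 *: (y ** (y ** ((y ** y) ** w))) - 4 *: (y ** (y ** (y ** (y ** w))))
    + (y ** y) ** ((y ** y) ** w).
  have -> : (y ** y) ** (y ** y) = (y ** (y ** y)) ** y.
    by rewrite jordan_identity (jmulC (y ** y) y) jmulC.
  rewrite jL_mul3 (jmulC (y ** y) y) !jL_cube !jmulE !jordan_identity.
  lin R.
rewrite /jU /jL !jmulE quad !jordan_identity; lin R.
Qed.

Lemma jU_1add_1sub y w : jU (jone + y) (jU (jone - y) w) = jU (jone - y ** y) w.
Proof.
have -> : jU (jone - y ** y) w = w - 2 *: ((y ** y) ** w) + jU y (jU y w).
  by rewrite -jU_sqr /jU /jL !jmulE; lin R.
by rewrite /jU /jL !jmulE !jordan_identity; lin R.
Qed.

Fixpoint jpow x n : V := if n is n'.+1 then x ** jpow x n' else jone.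

(** By [jL_mul3], [L_{x^(n+2)}] is a polynomial in [L_x], [L_{x^2}], [L_{x^n}] and [L_{x^(n+1)}], so
    two consecutive powers are carried through the induction. *)
Lemma jL_jpow_comm x (T : V -> V) :
  linear T -> (forall w, T (x ** w) = x ** T w) ->
  (forall w, T ((x ** x) ** w) = (x ** x) ** T w) ->
  forall n w, T (jpow x n ** w) = jpow x n ** T w.
Proof.
move=> Tlin Tx Txx.
suff step n : (forall w, T (jpow x n ** w) = jpow x n ** T w) /\
    (forall w, T (jpow x n.+1 ** w) = jpow x n.+1 ** T w).
  by move=> n; case: (step n).
elim: n => [|n [IHn IHn1]]; first by split=> w; rewrite /= ?jmulE ?jmulr1.
split=> // w.
have step u : jpow x n.+2 ** u =
    2 *: (x ** (jpow x n.+1 ** u)) + jpow x n ** ((x ** x) ** u)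
    - x ** (x ** (jpow x n ** u)) - jpow x n ** (x ** (x ** u)).
  by rewrite /= (jmulC x (x ** jpow x n)) jL_mul3 (jmulC (jpow x n) x); lin R.
rewrite !step !(linear_subf Tlin, linear_addf Tlin, linear_scalef Tlin).
by rewrite !(IHn, IHn1, Tx, Txx).
Qed.

(** Power associativity: [L_x] commutes with every [L_{x^m}], so a factor [x] can be moved out of
    the second power. *)
Lemma jmul_jpow x m n : jpow x m ** jpow x n = jpow x (m + n).
Proof.
elim: n => [|n IHn] in m *; first by rewrite /= jmulr1 addn0.
rewrite /= addnS /= -IHn; symmetry; apply: jL_jpow_comm => [|//|w].
  exact: jmul_linear.
by rewrite jordan_identity.
Qed.

(** Polynomial evaluation at [x]; by [jevM] it is multiplicative, so identities in one element
    reduce to [ring] in [{poly R}]. *)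
Definition jev x (p : {poly R}) : V := \sum_(i < size p) p`_i *: jpow x i.

Lemma jev_widen x p n : (size p <= n)%N -> jev x p = \sum_(i < n) p`_i *: jpow x i.
Proof.
move=> le_n; rewrite /jev (big_ord_widen _ (fun i => p`_i *: jpow x i) le_n).
rewrite [RHS](bigID (fun i : 'I_n => (i < size p)%N)) /= [X in _ + X]big1 ?addr0 //.
by move=> i; rewrite -leqNgt => /(nth_default 0) ->; rewrite scale0r.
Qed.

Lemma jevD x p q : jev x (p + q) = jev x p + jev x q.
Proof.
set n := maxn (size p) (size q).
rewrite (@jev_widen x (p + q) n) ?size_polyD //.
rewrite (@jev_widen x p n) ?leq_maxl //.
rewrite (@jev_widen x q n) ?leq_maxr // -big_split.
by apply: eq_bigr => i _; rewrite coefD scalerDl.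
Qed.

Lemma jevZ x c p : jev x (c *: p) = c *: jev x p.
Proof.
rewrite (jev_widen x (size_scale_leq c p)) // scaler_sumr.
by apply: eq_bigr => i _; rewrite coefZ scalerA.
Qed.

Lemma jev0 x : jev x 0 = 0.
Proof. by rewrite /jev size_poly0 big_ord0. Qed.

Lemma jevXn x n : jev x 'X^n = jpow x n.
Proof.
rewrite /jev size_polyXn big_ord_recr /= coefXn eqxx scale1r big1 ?add0r // => i _.
by rewrite coefXn ltn_eqF // scale0r.
Qed.

Lemma jevM x p q : jev x (p * q) = jev x p ** jev x q.
Proof.
have jev_sum (I : Type) (r : seq I) F :
    jev x (\sum_(i <- r) F i) = \sum_(i <- r) jev x (F i).
  by elim/big_rec2: _ => [|i y1 y2 _ <-]; rewrite ?jev0 ?jevD.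
have jmul_sumr y (I : Type) (r : seq I) F :
    y ** (\sum_(i <- r) F i) = \sum_(i <- r) y ** (F i).
  by elim/big_rec2: _ => [|i y1 y2 _ <-]; rewrite ?jmulr0 ?jmulDr.
rewrite -{1}[p]coefK -{1}[q]coefK !poly_def mulr_sumr jev_sum [jev x q]/jev jmul_sumr.
apply: eq_bigr => j _; rewrite mulr_suml jev_sum jmulC [jev x p]/jev jmul_sumr.
apply: eq_bigr => i _; rewrite -scalerAl -scalerAr !jevZ -exprD jevXn.
by rewrite jmulZl jmulZr (jmulC (jpow x j)) jmul_jpow !scalerA mulrC.
Qed.

Lemma jev1 x : jev x 1 = jone.
Proof. exact: (jevXn x 0). Qed.
Lemma jevX x : jev x 'X = x.
Proof. by rewrite -['X]expr1 jevXn; exact: jmulr1. Qed.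
Lemma jevN x p : jev x (- p) = - jev x p.
Proof. by rewrite -scaleN1r jevZ scaleN1r. Qed.
End JordanAlgebras.

(** * Bounded invertible operators and the Neumann series *)

Section InvertibleOperators.
Context {R : realType} {V : jbAlgType R}.
Implicit Types (x y z : V) (g h : V -> V).

Lemma bounded_operator_id : bounded_operator (@id V).
Proof. by split=> //; exists 1 => x; rewrite mul1r. Qed.

Lemma bounded_operator_comp g h :
  bounded_operator g -> bounded_operator h -> bounded_operator (g \o h).
Proof.
move=> [glin [M gM]] [hlin [N hN]]; split=> [a x y|]; first by rewrite /= hlin glin.
exists (`|M| * `|N|) => x /=; rewrite (le_trans (gM _)) //.
rewrite (le_trans (ler_wpM2r _ (ler_norm M))) // -mulrA ler_wpM2l //.
by rewrite (le_trans (hN _)) // ler_wpM2r // ler_norm.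
Qed.

Lemma GL_id : GL V id.
Proof. by split; [|exists id; split=> //]; exact: bounded_operator_id. Qed.

Lemma GL_comp g h : GL V g -> GL V h -> GL V (g \o h).
Proof.
move=> [gb [gi [gib gK giK]]] [hb [hi [hib hK hiK]]].
split; first exact: bounded_operator_comp.
exists (hi \o gi); split; first exact: bounded_operator_comp.
  exact: can_comp.
exact: can_comp.
Qed.

Lemma GL_inv g : GL V g -> exists h, [/\ GL V h, cancel g h & cancel h g].
Proof. by move=> [gb [h [hb gK hK]]]; exists h; split=> //; split=> //; exists g. Qed.

Lemma GL_scale c : c != 0 -> GL V (fun x => c *: x).
Proof.
have bnd a : bounded_operator (fun x : V => a *: x).
  split=> [b x y|]; first by lin R.
  by exists `|a| => x; rewrite normrZ.
move=> c0; split; first exact: bnd.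
exists (fun x => c^-1 *: x); split=> // x; first by rewrite scalerA mulVf ?scale1r.
by rewrite scalerA mulfV ?scale1r.
Qed.

(** With [k] inverse to [g \o h], commutation makes [k \o h] a left inverse of [g], while [h \o k]
    is a right inverse. *)
Lemma GL_of_comp g h :
  bounded_operator g -> bounded_operator h -> g \o h = h \o g -> GL V (g \o h) ->
  GL V g.
Proof.
move=> gb hb comm [_ [k [kb kK Kk]]]; split=> //.
have left_inv : cancel g (k \o h).
  by move=> x /=; rewrite -[h (g x)]/((h \o g) x) -comm kK.
have right_inv : cancel (h \o k) g by move=> x /=; rewrite -[RHS]Kk.
exists (k \o h); split=> //; first exact: bounded_operator_comp.
by move=> x; rewrite -{1}(right_inv x) left_inv right_inv.
Qed.

Lemma neumann_fixpoint (T : V -> V) k b :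
  linear T -> 0 <= k < 1 -> (forall x, `|T x| <= k * `|x|) -> exists x, x = b + T x.
Proof.
move=> Tlin /andP[k0 k1] TM.
pose f x := b + T x.
pose F : {fun [set: V] >-> [set: V]} :=
  HB.pack f (@isFun.Build _ _ setT setT f (fun _ _ => I)).
have [|||p _ pE] := @banach_fixed_point R V setT F.
- exists (NngNum k0); split=> //= -[x y] _ /=.
  by rewrite /f opprD addrACA subrr add0r -(linear_subf Tlin).
- exact: closedT.
- by exists 0.
by exists p; rewrite {1}pE.
Qed.

(** Surjectivity comes from the contraction [x |-> b + T x], injectivity and the bound on the
    inverse from [(1 - k) |x| <= |x - T x|]. *)
Lemma GL_neumann (T : V -> V) k :
  linear T -> 0 <= k < 1 -> (forall x, `|T x| <= k * `|x|) -> GL V (fun x => x - T x).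
Proof.
move=> Tlin kb TM; have [k0 k1] := andP kb.
have low x : (1 - k) * `|x| <= `|x - T x|.
  rewrite mulrBl mul1r (le_trans _ (lerB_dist _ _)) //.
  by rewrite lerD2l lerN2.
have glin : linear (fun x => x - T x) by move=> a x y; rewrite Tlin; lin R.
split.
  split=> //; exists (1 + k) => x; rewrite (le_trans (ler_normB _ _)) //.
  by rewrite mulrDl mul1r lerD2l.
have inj x y : x - T x = y - T y -> x = y.
  move=> exy; apply/subr0_eq/normr0_eq0/eqP; rewrite eq_le normr_ge0 andbT.
  rewrite -(pmulr_rle0 _ (_ : 0 < 1 - k)) ?subr_gt0 // (le_trans (low _)) //.
  by rewrite (linear_subf glin x y) /= exy subrr normr0.
have [h hK] : {h : V -> V & forall b, h b - T (h b) = b}.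
  apply: (@choice _ _ (fun b x => x - T x = b)) => b.
  by have [x xE] := neumann_fixpoint b Tlin kb TM; exists x; rewrite {1}xE addrK.
exists h; split=> // [|x]; last exact/inj/hK.
split=> [a x y|]; first by apply: inj; rewrite hK glin !hK.
exists (1 - k)^-1 => x; rewrite ler_pdivlMl ?subr_gt0 // (le_trans (low _)) //.
by rewrite hK.
Qed.

End InvertibleOperators.

(** * Invertibility criteria and the spectral role of the norm *)

Section SpectralTheory.
Context {R : realType} {V : jbAlgType R}.
Implicit Types (x y z : V) (c t r M : R) (p q : {poly R}).
Local Notation "x ** y" := (jmul x y) (at level 40, left associativity).
Local Notation "1v" := (jone : V).

(** The norm of the unit is idempotent, hence 0 or 1; the value 0 occurs in the zero algebra. *)
Lemma norm_jone : `|1v| <= 1.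
Proof.
have := jb_norm_sqr 1v; rewrite jmul1 => /eqP; rewrite expr2 -subr_eq0.
rewrite -{1}[`|1v|]mulr1 -mulrBr mulf_eq0 subr_eq0.
by case/orP=> /eqP; [move=> -> | move=> <-].
Qed.

Lemma pow_small r e : 0 <= r < 1 -> 0 < e -> exists N, r ^+ N < e.
Proof.
move=> /andP[r0 r1] e0; have r1' : `|r| < 1 by rewrite ger0_norm.
have /cvgrPdist_lt/(_ e e0)[N _ NP] := cvg_expr r1'.
exists N; have := NP N (leqnn N).
by rewrite /= sub0r normrN ger0_norm // exprn_ge0.
Qed.

Lemma jU_linear x : linear (jU x).
Proof. by move=> a u v; rewrite /jU /jL !jmulE; lin R. Qed.

Lemma norm_jU x y : `|jU x y| <= 3 * `|x| ^+ 2 * `|y|.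
Proof.
rewrite /jU /jL (le_trans (ler_normB _ _)) // normrZ ger0_norm //.
have n1 : `|x ** (x ** y)| <= `|x| * (`|x| * `|y|).
  by rewrite (le_trans (jb_normM _ _)) // ler_wpM2l // jb_normM.
have n2 : `|(x ** x) ** y| <= `|x| ^+ 2 * `|y|.
  by rewrite (le_trans (jb_normM _ _)) // jb_norm_sqr.
by nra.
Qed.

Lemma jU_bounded x : bounded_operator (jU x).
Proof. by split; [exact: jU_linear | eexists => y; exact: norm_jU]. Qed.

Lemma jinvertible_sqr x : jinvertible (x ** x) <-> jinvertible x.
Proof.
rewrite /jinvertible (_ : jU (x ** x) = jU x \o jU x); last first.
  by apply/funext => w; exact: jU_sqr.
split; last by move=> inv; exact: GL_comp.
by move=> inv; apply: (GL_of_comp _ _ _ inv) => //; exact: jU_bounded.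
Qed.

Lemma jinvertible_1sub_sqr x :
  jinvertible (1v - x ** x) <-> jinvertible (1v - x) /\ jinvertible (1v + x).
Proof.
have E1 : jU (1v - x ** x) = jU (1v - x) \o jU (1v + x).
  apply/funext => w; have := jU_1add_1sub (- x) w.
  by rewrite !jmulE !opprK => <-.
have E2 : jU (1v - x ** x) = jU (1v + x) \o jU (1v - x).
  by apply/funext => w; rewrite -jU_1add_1sub.
rewrite /jinvertible; split=> [|[inv1 inv2]]; last by rewrite E1; exact: GL_comp.
move=> inv; have comm : jU (1v - x) \o jU (1v + x) = jU (1v + x) \o jU (1v - x).
  by rewrite -E1 -E2.
have bU := jU_bounded; split.
  by apply: (GL_of_comp _ _ comm) => //; rewrite -E1.
by apply: (GL_of_comp _ _ (esym comm)) => //; rewrite -E2.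
Qed.

Lemma jinvertible_scale c x : c != 0 -> jinvertible x -> jinvertible (c *: x).
Proof.
move=> c0 inv; rewrite /jinvertible.
rewrite (_ : jU (c *: x) = (fun y => (c ^+ 2) *: y) \o jU x).
  by apply: GL_comp => //; apply: GL_scale; rewrite expf_neq0.
by apply/funext => w; rewrite /jU /jL /= !jmulE; lin R.
Qed.

(** Here [U_{1-y} = Id - (2 L_y - U_y)], and [2 r + 3 r^2 < 1] for [0 <= r < 1/4]. *)
Lemma jinvertible_1sub_small y : `|y| < 4^-1 -> jinvertible (1v - y).
Proof.
move=> y4; rewrite /jinvertible.
rewrite (_ : jU (1v - y) = fun w => w - (2 *: (y ** w) - jU y w)); last first.
  by apply/funext => w; rewrite /jU /jL !jmulE; lin R.
apply: (GL_neumann (k := 2 * `|y| + 3 * `|y| ^+ 2)).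
- by move=> a u v; rewrite jU_linear !jmulE; lin R.
- have y0 := normr_ge0 y; have ub : 2 * `|y| + 3 * `|y| ^+ 2 < 1 by nra.
  by rewrite ub andbT addr_ge0 ?mulr_ge0 ?exprn_ge0.
move=> w; rewrite (le_trans (ler_normB _ _)) // normrZ ger0_norm // [leRHS]mulrDl.
apply: lerD; last exact: norm_jU.
by rewrite -mulrA ler_wpM2l // jb_normM.
Qed.

(* U_(1-y) divides U_(1-y^2), U_(1-y^4), ..., and y^(2^k) tends to 0. *)
Lemma jinvertible_1sub y : `|y| < 1 -> jinvertible (1v - y).
Proof.
move=> y1; have [||k yk] := @pow_small `|y| 4^-1; rewrite ?normr_ge0 ?invr_gt0 //.
have {}yk : `|y| ^+ (2 ^ k) < 4^-1.
  apply: le_lt_trans yk; apply: ler_wiXn2l => //; first exact: ltW.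
  exact/ltnW/ltn_expl.
elim: k y {y1} yk => [|k IHk] y yk; first by apply: jinvertible_1sub_small.
suff /jinvertible_1sub_sqr[] : jinvertible (1v - y ** y) by [].
apply: IHk.
by rewrite jb_norm_sqr -exprM -expnS.
Qed.

Lemma jinvertible_norm c x : `|c *: 1v - x| < c -> jinvertible x.
Proof.
move=> xc; have c0 : 0 < c by rewrite (le_lt_trans _ xc).
have -> : x = c *: (1v - c^-1 *: (c *: 1v - x)) by lin R; lra.
apply: jinvertible_scale; first by rewrite gt_eqF.
apply: jinvertible_1sub; rewrite normrZ gtr0_norm ?invr_gt0 //.
by rewrite mulrC ltr_pdivrMr // mul1r.
Qed.

Lemma jU_jev z p q : jU (jev z p) (jev z q) = jev z (p ^+ 2 * q).
Proof.
rewrite /jU /jL -!jevM -jevZ -jevN -jevD; congr (jev z _).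
by rewrite scaler_nat; ring.
Qed.

Lemma norm_jevM z p q : `|jev z (p * q)| <= `|jev z p| * `|jev z q|.
Proof. by rewrite jevM jb_normM. Qed.

Lemma norm_jev_sqr z p : `|jev z (p ^+ 2)| = `|jev z p| ^+ 2.
Proof. by rewrite expr2 jevM jb_norm_sqr. Qed.

Lemma norm_jev_sqrD z p q : `|jev z (p ^+ 2)| <= `|jev z (p ^+ 2 + q ^+ 2)|.
Proof. by rewrite jevD !expr2 !jevM jb_norm_sqrD. Qed.

Lemma norm_jev1 z : `|jev z 1| <= 1.
Proof. by rewrite jev1 norm_jone. Qed.

Lemma norm_jevXn_le z n : `|z| <= 1 -> `|jev z ('X^n)| <= 1.
Proof.
move=> z1; elim: n => [|n IHn]; first by rewrite expr0 norm_jev1.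
by rewrite exprS (le_trans (norm_jevM _ _ _)) // mulr_ile1 // jevX.
Qed.

(** Repeated squaring gives norm one at the exponents [2 ^ n]; all powers have norm at most one, so
    the factor [z^n] of [z^(2^n)] cannot have a smaller norm. *)
Lemma norm_jevXn z n : `|z| = 1 -> `|jev z ('X^n)| = 1.
Proof.
move=> z1; have le1 m : `|jev z ('X^m)| <= 1 by rewrite norm_jevXn_le ?z1.
apply/eqP; rewrite eq_le le1 /=.
have <- : `|jev z ('X^(2 ^ n))| = 1.
  elim: n => [|n IHn]; first by rewrite expr1 jevX.
  by rewrite expnSr exprM norm_jev_sqr IHn expr1n.
rewrite -(subnK (ltnW (ltn_expl n (ltnSn 1)))) exprD.
by rewrite (le_trans (norm_jevM _ _ _)) // ler_piMl.
Qed.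

(** The sum of ['X^(2 * i)] over [i < 2 ^ k] in product form, a partial sum of the formal inverse of
    [1 - 'X^2]. *)
Fixpoint geom_poly k : {poly R} :=
  if k is k'.+1 then geom_poly k' * (1 + 'X^(2 ^ k' * 2)) else 1.

Lemma geom_polyE k : (1 - 'X^2) * geom_poly k = 1 - 'X^(2 ^ k * 2).
Proof.
elim: k => [|k IHk] /=; first by rewrite mulr1.
by rewrite mulrA IHk expnSr (exprM _ (2 ^ k * 2) 2); ring.
Qed.

(* (1 + w^m)^2 = (1 - w^m)^2 + 4 w^m with w = z^2, so each factor 1 + w^m of the
   geometric sum contributes a factor 2 in norm. *)
Lemma norm_geom_poly z k j :
  `|z| = 1 -> 2 ^+ k <= `|jev z (geom_poly k * 'X^j)|.
Proof.
move=> z1; elim: k j => [|k IHk] j; first by rewrite expr0 mul1r norm_jevXn.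
rewrite -(ler_pXn2r (n := 2)) ?nnegrE ?exprn_ge0 // -norm_jev_sqr.
have -> : (geom_poly k.+1 * 'X^j) ^+ 2 =
    (2 *: (geom_poly k * 'X^(j + 2 ^ k))) ^+ 2 +
    (geom_poly k * (1 - 'X^(2 ^ k * 2)) * 'X^j) ^+ 2.
  by rewrite /= scaler_nat exprD exprM; ring.
rewrite (le_trans _ (norm_jev_sqrD _ _ _)) // norm_jev_sqr.
rewrite lerXn2r ?nnegrE ?exprn_ge0 // jevZ normrZ ger0_norm // exprS.
by rewrite ler_wpM2l.
Qed.

(** [U_{1-z^2}] sends the geometric sum, of norm at least [2 ^ k], to [(1 - z^2) (1 - z^(2^(k+1)))],
    of norm at most 4; hence it has no bounded inverse. *)
Lemma norm_in_spectrum z : `|z| = 1 -> ~ jinvertible (1v - z ** z).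
Proof.
move=> z1 [_ [h [[_ [M hM]] hK _]]].
have evE : 1v - z ** z = jev z (1 - 'X^2) by rewrite jevD jevN jev1 expr2 jevM jevX.
have bnd k : 2 ^+ k <= `|M| * 4.
  have := norm_geom_poly k 0 z1; rewrite expr0 mulr1 => /le_trans; apply.
  rewrite -[jev z _]hK (le_trans (hM _)) // evE jU_jev.
  rewrite (le_trans (ler_wpM2r _ (ler_norm M))) // ler_wpM2l //.
  rewrite expr2 -mulrA geom_polyE (le_trans (norm_jevM _ _ _)) //.
  have two n : `|jev z (1 - 'X^n)| <= 2.
    rewrite jevD jevN (le_trans (ler_normB _ _)) //.
    by rewrite (_ : 2 = 1 + 1) // lerD ?norm_jev1 // norm_jevXn.
  rewrite (_ : 4 = 2 * 2 :> R); last by rewrite -natrM.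
  exact: ler_pM.
pose n := Num.bound (`|M| * 4).
have := archi_boundP (_ : 0 <= `|M| * 4); rewrite mulr_ge0 // => /(_ isT).
rewrite ltNge => /negP; apply; apply: le_trans (bnd n).
by rewrite -natrX ler_nat; exact/ltnW/ltn_expl.
Qed.

(** Rescaled to norm one, a nonzero [x] falls under [norm_in_spectrum]: one of [|x|] and [-|x|] lies
    in its spectrum. *)
Lemma norm_spectral x :
  jinvertible (`|x| *: 1v - x) -> jinvertible (`|x| *: 1v + x) -> x = 0.
Proof.
move=> inv1 inv2; apply/eqP/negPn/negP => x0.
have nx0 : `|x| != 0 by rewrite normr_eq0.
have [] := @norm_in_spectrum (`|x|^-1 *: x).
  by rewrite normrZ normfV normr_id mulVf.
have sc c : jinvertible (`|x| *: 1v + c *: x) -> jinvertible (1v + c *: (`|x|^-1 *: x)).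
  move=> inv; have -> : 1v + c *: (`|x|^-1 *: x) = `|x|^-1 *: (`|x| *: 1v + c *: x).
    by lin R.
  by apply: jinvertible_scale; rewrite ?invr_eq0.
apply/jinvertible_1sub_sqr; split.
  by have := sc (-1); rewrite !scaleN1r; apply.
by have := sc 1; rewrite !scale1r; apply.
Qed.

End SpectralTheory.

(** * The positive cone, squares and the Newton-Schulz iteration *)

Section PositiveCone.
Context {R : realType} {V : jbAlgType R}.
Implicit Types (x y z a b s : V) (f g h k : V -> V) (c t r M : R) (p q P : {poly R}).
Local Notation "x ** y" := (jmul x y) (at level 40, left associativity).
Local Notation "1v" := (jone : V).

Lemma OmegaP x : Omega V x <-> forall t, 0 <= t -> jinvertible (x + t *: 1v).
Proof.
split=> [Ox t t0 | inv l]; last first.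
  rewrite /spectrum /= => ninv; rewrite ltNge; apply/negP => l0; apply: ninv.
  by rewrite -scaleNr; apply: inv; rewrite oppr_ge0.
apply: contrapT => ninv; have := Ox (- t); rewrite /spectrum /= scaleNr opprK.
by move=> /(_ ninv); rewrite oppr_gt0 ltNge t0.
Qed.

Lemma Omega_jinvertible x : Omega V x -> jinvertible x.
Proof. by move=> /OmegaP/(_ 0 (lexx 0)); rewrite scale0r addr0. Qed.

Lemma Omega_of_norm M x : `|M *: 1v - x| < M -> Omega V x.
Proof.
move=> xM; apply/OmegaP => t t0; apply: (jinvertible_norm (c := M + t)).
rewrite (_ : _ - _ = M *: 1v - x); last by lin R.
by rewrite (lt_le_trans xM) // lerDl.
Qed.

(** If [z = M 1 - x] had norm [l >= M], both [l 1 - z = x + (l - M) 1] and [l 1 + z = (l + M) 1 - x]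
    would be invertible, and [norm_spectral] would force [z = 0]. *)
Lemma Omega_norm x M : Omega V x -> `|x| < M -> `|M *: 1v - x| < M.
Proof.
move=> /OmegaP Ox xM; rewrite ltNge; apply/negP => le_Mz.
have M0 : 0 < M by rewrite (le_lt_trans _ xM).
have z0 : M *: 1v - x = 0.
  apply: norm_spectral; set l := `|_| in le_Mz *.
    rewrite (_ : _ - _ = x + (l - M) *: 1v); last by lin R.
    by apply: Ox; rewrite subr_ge0.
  apply: (jinvertible_norm (c := l + M)).
  rewrite (_ : _ - _ = x); last by lin R.
  by rewrite (lt_le_trans xM) // lerDr (le_trans _ le_Mz) // ltW.
by move: le_Mz; rewrite z0 normr0 leNgt M0.
Qed.

Lemma Omega_normP x : Omega V x <-> exists M, `|M *: 1v - x| < M.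
Proof.
split=> [Ox|[M]]; last exact: Omega_of_norm.
by exists (`|x| + 1); apply: Omega_norm; rewrite // ltrDl.
Qed.

Lemma OmegaD x y : Omega V x -> Omega V y -> Omega V (x + y).
Proof.
move=> /Omega_normP[M xM] /Omega_normP[N yN]; apply: (@Omega_of_norm (M + N)).
rewrite (_ : _ - _ = (M *: 1v - x) + (N *: 1v - y)); last by lin R.
by rewrite (le_lt_trans (ler_normD _ _)) // ltrD.
Qed.

Lemma OmegaZ c x : 0 < c -> Omega V x -> Omega V (c *: x).
Proof.
move=> c0 /Omega_normP[M xM]; apply: (@Omega_of_norm (c * M)).
by rewrite -scalerA -scalerBr normrZ gtr0_norm // ltr_pM2l.
Qed.

Lemma Omega_unit_ball t y : `|y| < t -> Omega V (t *: 1v + y).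
Proof.
by move=> yt; apply: (@Omega_of_norm t); rewrite opprD addrA subrr add0r normrN.
Qed.

Lemma Omega_scale1 t : 0 < t -> Omega V (t *: 1v).
Proof. by move=> t0; rewrite -[t *: _]addr0; apply: Omega_unit_ball; rewrite normr0. Qed.

Lemma Omega_open x :
  Omega V x -> exists2 d, 0 < d & forall y, `|y| < d -> Omega V (x + y).
Proof.
move=> /Omega_normP[M xM]; exists (M - `|M *: 1v - x|); rewrite ?subr_gt0 // => y yd.
apply: (@Omega_of_norm M); rewrite opprD addrA.
by rewrite (le_lt_trans (ler_normB _ _)) // -ltrBrDl.
Qed.

Lemma Omega_closed x :
  jinvertible x -> (forall e, 0 < e -> Omega V (x + e *: 1v)) -> Omega V x.
Proof.
move=> inv Ox; apply/OmegaP => t; rewrite le_eqVlt => /predU1P[<-|t0].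
  by rewrite scale0r addr0.
exact/Omega_jinvertible/Ox.
Qed.

Lemma Omega_pointed x :
  (forall e, 0 < e -> Omega V (x + e *: 1v)) ->
  (forall e, 0 < e -> Omega V (- x + e *: 1v)) -> x = 0.
Proof.
move=> Ox ONx; apply/eqP/negPn/negP => x0.
have nx0 : 0 < `|x| by rewrite normr_gt0.
move/eqP: x0; apply; apply: norm_spectral; rewrite addrC; apply: Omega_jinvertible.
  exact: ONx.
exact: Ox.
Qed.

(* On the ray from y to infinity in the direction b the elements of Omega
   form a relatively open and closed subset. *)
Lemma Omega_of_ray b y :
  Omega V b -> (forall t, 0 <= t -> jinvertible (y + t *: b)) -> Omega V y.
Proof.
move=> Ob inv; pose A := [set t : R | 0 <= t /\ Omega V (y + t *: b)].
have A_lb : lbound A 0 by move=> t [].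
have A_ne : A !=set0.
  have [d d0 bd] := Omega_open Ob.
  (* For this [t], [y / t] has norm below [d], so [y + t b = t (b + y / t)] lies in the cone. *)
  pose t := (`|y| + 1) / d.
  have t0 : 0 < t by rewrite divr_gt0 // ltr_wpDl.
  exists t; split; first exact: ltW.
  rewrite (_ : y + _ = t *: (b + t^-1 *: y)); last by lin R; rewrite gt_eqF.
  apply: OmegaZ => //; apply: bd.
  rewrite normrZ gtr0_norm ?invr_gt0 // /t invf_div mulrAC ltr_pdivrMr ?ltr_wpDl //.
  by rewrite ltr_pM2l // ltrDl.
have A_inf : has_inf A by split=> //; exists 0.
(* Relative closedness puts [m] into [A]; openness would then give a smaller element of [A] unless
   [m = 0]. *)
set m := inf A; have m0 : 0 <= m by exact: lb_le_inf.
have Om : Omega V (y + m *: b).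
  apply: Omega_closed; first exact: inv.
  move=> e e0; have eb : 0 < e / (`|b| + 1) by rewrite divr_gt0 // ltr_wpDl.
  have [t [t0 Ot] tm] := inf_adherent eb A_inf.
  have mt : m <= t by apply: ge_inf => //; case: A_inf.
  rewrite (_ : _ + e *: _ = (y + t *: b) + (e *: 1v + (m - t) *: b)); last by lin R.
  apply: OmegaD => //; apply: Omega_unit_ball.
  rewrite normrZ ler0_norm ?subr_le0 // opprB.
  move: tm; rewrite -ltrBlDl -/m ltr_pdivlMr ?ltr_wpDl // => /(le_lt_trans _); apply.
  by rewrite ler_wpM2l ?subr_ge0 // lerDl.
suff m_le0 : m <= 0.
  by move: Om; rewrite (_ : m = 0) ?scale0r ?addr0 //; apply/eqP; rewrite eq_le m_le0.
rewrite leNgt; apply/negP => m_gt0; have [d d0 yd] := Omega_open Om.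
pose e := Num.min m (d / (`|b| + 1)).
have e0 : 0 < e by rewrite lt_min m_gt0 divr_gt0 // ltr_wpDl.
have Ae : A (m - e).
  split; first by rewrite subr_ge0 ge_min lexx.
  rewrite (_ : _ + _ = (y + m *: b) + (- e) *: b); last by lin R.
  apply: yd; rewrite normrZ normrN gtr0_norm //.
  have : e <= d / (`|b| + 1) by rewrite ge_min lexx orbT.
  rewrite ler_pdivlMr ?ltr_wpDl //; apply: lt_le_trans.
  by rewrite ltr_pM2l // ltrDl.
have := ge_inf A_inf.2 Ae; rewrite -/m lerBrDr gerDl.
by rewrite leNgt e0.
Qed.

(* The Newton-Schulz iteration: newtonQ approximates (1 - P)^(-1/2), with
   quadratically decreasing defect newtonE. *)
Fixpoint newtonE (P : {poly R}) n : {poly R} :=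
  if n is n'.+1 then
    let E := newtonE P n' in (3 / 4) *: E ^+ 2 + 4^-1 *: E ^+ 3
  else P.

Fixpoint newtonQ (P : {poly R}) n : {poly R} :=
  if n is n'.+1 then newtonQ P n' * (1 + 2^-1 *: newtonE P n') else 1.

(** The recursion for [newtonE] is read off from [(1 - E) (1 + E/2)^2 = 1 - (3/4) E^2 - (1/4)
    E^3]. *)
Lemma newtonQE P n : (1 - P) * newtonQ P n ^+ 2 = 1 - newtonE P n.
Proof.
elim: n => [|n IHn] /=; first by rewrite expr1n mulr1.
have half : 2^-1 = 2 * 4^-1 :> R by field.
rewrite exprMn mulrA IHn half -!scalerA !scaler_nat -!mul_polyC.
have four : (4^-1)%:P *+ 4 = 1 :> {poly R} by rewrite -polyCMn -[4^-1 *+ 4]mulr_natr mulVf.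
set f := (4^-1)%:P in four *; set E := newtonE P n; apply/eqP; rewrite -subr_eq0.
(* As [ring] sees [f] as an atom, the difference of the two sides is exhibited as a multiple of
   [4 f - 1], which vanishes. *)
rewrite (_ : _ - _ = (f *+ 4 - 1) * (E + f * E ^+ 2 - f * E ^+ 3)); last by ring.
by rewrite four subrr mul0r.
Qed.

(** The weights 3/4 and 1/4 add up to 1, so the next defect is at most [(r^(n+1))^2 <= r^(n+2)];
    this geometric rate is enough for the limits below. *)
Lemma norm_newtonE z P r n :
  r <= 1 -> `|jev z P| <= r -> `|jev z (newtonE P n)| <= r ^+ n.+1.
Proof.
move=> r1 Pr; have r0 : 0 <= r by exact: le_trans Pr.
elim: n => [|n IHn] //=; set E := newtonE P n in IHn *.
have a0 : 0 <= r ^+ n.+1 by exact: exprn_ge0.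
have ar : r ^+ n.+1 <= r by rewrite exprS ler_piMr // exprn_ile1.
rewrite jevD !jevZ (le_trans (ler_normD _ _)) // !normrZ norm_jev_sqr.
have : `|jev z (E ^+ 3)| <= `|jev z E| ^+ 3.
  rewrite exprS (le_trans (norm_jevM _ _ _)) // norm_jev_sqr -exprS.
  exact: lexx.
rewrite !ger0_norm ?divr_ge0 ?invr_ge0 // exprSr [_ ^+ n.+2]exprSr.
set e := `|jev z E| in IHn *; set a := r ^+ n.+1 in a0 ar IHn *.
have e0 : 0 <= e by exact: normr_ge0.
have ea : e ^+ 2 <= a ^+ 2 by rewrite lerXn2r ?nnegrE.
have ea3 : e ^+ 2 * e <= a ^+ 2.
  by rewrite (le_trans _ ea) // ler_piMr ?exprn_ge0 // (le_trans IHn) // (le_trans ar).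
have aa : a ^+ 2 <= a * r by rewrite expr2 ler_wpM2l.
by move=> E3; lra.
Qed.

(* With w = x^2, (1 - 2 w)^2 + 4 w (1 - w) = 1 and 4 w (1 - w) is a limit of squares. *)
Lemma norm_1sub2sqr x : `|x| < 1 -> `|1v - 2 *: (x ** x)| <= 1.
Proof.
move=> x1; pose P : {poly R} := 'X^2; pose r := `|x| ^+ 2.
have r0 : 0 <= r by exact: exprn_ge0.
have r1 : r < 1 by rewrite /r expr_lt1.
have Pr : `|jev x P| <= r by rewrite norm_jev_sqr jevX.
have evE : jev x (1 - 2 *: P) = 1v - 2 *: (x ** x).
  by rewrite jevD jevN jevZ jev1 /P expr2 jevM jevX.
have bnd n : `|1v - 2 *: (x ** x)| ^+ 2 <= 1 + 8 * r ^+ n.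
  rewrite -evE -norm_jev_sqr.
  (* The square of the added term is [4 P (1 - P) (1 - newtonE P n)], so the sum of the squares
     differs from 1 only by a multiple of the defect. *)
  apply: le_trans (norm_jev_sqrD _ _ (2 *: ('X * (1 - P) * newtonQ P n))) _.
  have -> : (1 - 2 *: P) ^+ 2 + (2 *: ('X * (1 - P) * newtonQ P n)) ^+ 2 =
      1 - 4 *: (P * (1 - P) * newtonE P n).
    have -> : newtonE P n = 1 - (1 - P) * newtonQ P n ^+ 2.
      by rewrite newtonQE; ring.
    by rewrite !scaler_nat /P; ring.
  rewrite jevD jevN jevZ (le_trans (ler_normB _ _)) // lerD ?norm_jev1 //.
  rewrite normrZ ger0_norm // (_ : 8 = 4 * 2 :> R); last by rewrite -natrM.
  rewrite -[leRHS]mulrA ler_wpM2l // (le_trans (norm_jevM _ _ _)) //.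
  have rn : `|jev x (newtonE P n)| <= r ^+ n.
    rewrite (le_trans (norm_newtonE n (ltW r1) Pr)) // ler_wiXn2l // ltW //.
  apply: ler_pM => //; rewrite (le_trans (norm_jevM _ _ _)) //.
  rewrite -[leRHS]mul1r; apply: ler_pM => //; first exact/(le_trans Pr)/ltW.
  rewrite jevD jevN (le_trans (ler_normB _ _)) // (_ : 2 = 1 + 1) // lerD ?norm_jev1 //.
  exact/(le_trans Pr)/ltW.
rewrite -(ler_pXn2r (n := 2)) ?nnegrE // expr1n leNgt; apply/negP => gt1.
set N := _ ^+ 2 in bnd gt1.
have [||n rn] := @pow_small R r ((N - 1) / 8); rewrite ?r0 ?r1 ?divr_gt0 ?subr_gt0 //.
by have := bnd n; move: rn; rewrite ltr_pdivlMr //; lra.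
Qed.

(** After rescaling to [|y| < 1], [norm_1sub2sqr] puts [y^2 + s 1] at distance at most [1/2] from
    [(1/2 + s) 1]. *)
Lemma Omega_sqrD x t : 0 < t -> Omega V (x ** x + t *: 1v).
Proof.
move=> t0; pose c := `|x| + 1; have c0 : 0 < c by rewrite ltr_wpDl.
pose y := c^-1 *: x; have y1 : `|y| < 1.
  by rewrite normrZ gtr0_norm ?invr_gt0 // mulrC ltr_pdivrMr // mul1r ltrDl.
have -> : x ** x + t *: 1v = c ^+ 2 *: (y ** y + (t / c ^+ 2) *: 1v).
  by rewrite /y !jmulE; lin R; rewrite gt_eqF.
have s0 : 0 < t / c ^+ 2 by rewrite divr_gt0 // exprn_gt0.
apply: OmegaZ; first by rewrite exprn_gt0.
set s := t / _ in s0 *.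
apply: (@Omega_of_norm (2^-1 + s)).
rewrite (_ : _ - _ = 2^-1 *: (1v - 2 *: (y ** y))); last by lin R.
rewrite normrZ gtr0_norm ?invr_gt0 //.
by have := norm_1sub2sqr y1; lra.
Qed.

Lemma Omega_sqr x : jinvertible x -> Omega V (x ** x).
Proof.
move=> inv; apply: Omega_closed; first exact/jinvertible_sqr.
by move=> e; exact: Omega_sqrD.
Qed.

Lemma geometric_limit (u : nat -> V) r :
  0 <= r < 1 -> (forall n, `|u n.+1 - u n| <= r ^+ n) ->
  exists s, forall e, 0 < e -> exists N, forall n, (N <= n)%N -> `|s - u n| < e.
Proof.
move=> /andP[r0 r1] ur.
have sv : cvgn (series (telescope u)).
  apply: normed_cvg; apply: (series_le_cvg (v_ := geometric 1 r)) => [n|n|n|] /=.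
  - exact: normr_ge0.
  - by rewrite mul1r exprn_ge0.
  - by rewrite mul1r; exact: ur.
  - by apply: is_cvg_geometric_series; rewrite ger0_norm.
exists (limn (series (telescope u)) + u 0) => e e0.
have /cvgrPdist_lt/(_ e e0)[N _ NP] := sv.
exists N => n Nn; have := NP n Nn.
by rewrite /= telescopeK opprB addrA.
Qed.

(** The sum is [(1 + t) q], where [1 - q^2] is a combination of [E], [E^2] and [E^3], [E] the
    defect, with nonnegative weights of sum 1; hence [|1 - q^2| < 1]. This lets [Omega_of_ray] pass
    from one iterate to the next. *)
Lemma newton_path a n t :
  `|jev a (1 - 'X^2)| < 1 -> 0 <= t ->
  jinvertible (jev a ('X * newtonQ (1 - 'X^2) n.+1) +
    t *: jev a ('X * newtonQ (1 - 'X^2) n)).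
Proof.
have [P PE] : {P | P = 1 - 'X^2 :> {poly R}} by exists (1 - 'X^2).
rewrite -!PE => a1 t0; set r := `|_| in a1; have r0 : 0 <= r by exact: normr_ge0.
have Er : `|jev a (newtonE P n)| <= r.
  rewrite (le_trans (norm_newtonE n (ltW a1) (lexx _))) //.
  by rewrite exprS ler_piMr ?exprn_ile1 // ltW.
set E := newtonE P n in Er *; pose c := (1 + t)^-1.
have t1 : 0 < 1 + t by lra.
have c0 : 0 < c by rewrite invr_gt0.
have c1 : c <= 1 by rewrite invf_le1 // lerDl.
pose q := 'X * newtonQ P n * (1 + (c / 2) *: E).
have -> : jev a ('X * newtonQ P n.+1) + t *: jev a ('X * newtonQ P n) =
    (1 + t) *: jev a q.
  rewrite -!jevZ -jevD; congr (jev a _); rewrite /= /q -/E.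
  rewrite mulrA !mulrDr !mulr1 -!scalerAr [RHS]scalerDr scalerA.
  have -> : (1 + t) * (c / 2) = 2^-1 by rewrite mulrA mulfV ?mul1r // gt_eqF.
  by lin R.
apply: jinvertible_scale; first by rewrite gt_eqF.
apply/jinvertible_sqr; apply: (jinvertible_norm (c := 1)).
rewrite scale1r -jevM -(jev1 a) -jevN -jevD.
have -> : 1 - q * q =
    (1 - c) *: E + (c - c ^+ 2 / 4) *: E ^+ 2 + (c ^+ 2 / 4) *: E ^+ 3.
  have -> : q * q = (1 - E) * (1 + (c / 2) *: E) ^+ 2.
    rewrite -(newtonQE P n) /q; set W := 1 + _ *: _; set Q := newtonQ P n.
    by rewrite PE; ring.
  have half : c / 2 *: E = (c / 2)%:P * E by rewrite mul_polyC.
  have -> : c - c ^+ 2 / 4 = (c / 2) *+ 2 - (c / 2) ^+ 2 by field.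
  have -> : c ^+ 2 / 4 = (c / 2) ^+ 2 by field.
  have -> : 1 - c = 1 - (c / 2) *+ 2 by field.
  rewrite -!mul_polyC !(polyCB, polyCMn, polyCM, polyC1, polyC_exp).
  by ring.
rewrite !jevD !jevZ; set e := `|jev a E| in Er.
have e0 : 0 <= e by exact: normr_ge0.
have E2 : `|jev a (E ^+ 2)| <= r.
  by rewrite norm_jev_sqr -/e expr2 (le_trans _ Er) // ler_piMl // (le_trans Er) // ltW.
have E3 : `|jev a (E ^+ 3)| <= r.
  rewrite exprS (le_trans (norm_jevM _ _ _)) // (le_trans _ E2) //.
  by rewrite ler_piMl // (le_trans Er) // ltW.
have c2 : 0 <= c - c ^+ 2 / 4 by nra.
have c3 : 0 <= c ^+ 2 / 4 by rewrite divr_ge0 // exprn_ge0 // ltW.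
have c4 : 0 <= 1 - c by rewrite subr_ge0.
rewrite (le_lt_trans (ler_normD _ _)) //.
have := ler_normD ((1 - c) *: jev a E) ((c - c ^+ 2 / 4) *: jev a (E ^+ 2)).
rewrite !normrZ !(@ger0_norm R) //; last exact: ltW.
have := ler_wpM2l c2 E2; have := ler_wpM2l c3 E3; have := ler_wpM2l c4 Er.
rewrite -/e; move: (c ^+ 2 / 4) => d; lra.
Qed.

Lemma norm_newtonQ a n :
  `|jev a (1 - 'X^2)| < 1 -> `|jev a ('X * newtonQ (1 - 'X^2) n)| <= 2.
Proof.
move=> a1; set P := 1 - 'X^2 in a1 *.
rewrite -(ler_pXn2r (n := 2)) ?nnegrE // -norm_jev_sqr.
have -> : ('X * newtonQ P n) ^+ 2 = 1 - newtonE P n by rewrite -newtonQE /P; ring.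
have E1 : `|jev a (newtonE P n)| <= 1.
  by rewrite (le_trans (norm_newtonE n (lexx _) _)) ?expr1n // ltW.
rewrite jevD jevN (le_trans (ler_normB _ _)) //.
by have := norm_jev1 a; lra.
Qed.

End PositiveCone.

(** * Central symmetries and the cosets of [GOmega] *)

Section CentralSymmetries.
Context {R : realType} {V : jbAlgType R}.
Implicit Types (x y z b s p : V) (g h k f : V -> V).
Local Notation "x ** y" := (jmul x y) (at level 40, left associativity).
Local Notation "1v" := (jone : V).

Section InvertibilityPreserving.
Variables (h g : V -> V).
Hypotheses (hGL : GL V h) (gK : cancel g h) (hK : cancel h g).
Hypothesis h_inv : forall y, jinvertible (h y) <-> jinvertible y.

Let h_lin : linear h := hGL.1.1.

(** In the application [h] is the inverse of an element of [Str V]; the cone under study is the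
    preimage of [Omega] under [h]. *)
Lemma Omega_of_ray_image b y :
  Omega V (h b) -> (forall t, 0 <= t -> jinvertible (y + t *: b)) -> Omega V (h y).
Proof.
move=> Ob inv; apply: (Omega_of_ray Ob) => t t0.
by rewrite -(linear_scalef h_lin) -(linear_addf h_lin); apply/h_inv/inv.
Qed.

(* The sign of a = h^-1(1): the Newton-Schulz iterates of a normalised multiple
   of a all lie in the cone h^-1(Omega). *)
Lemma exists_symmetry : exists2 s, s ** s = 1v & Omega V (h s).
Proof.
have Oh : Omega V (h (g 1v)) by rewrite gK -[1v]scale1r; exact: Omega_scale1.
have /Omega_sqr/Omega_normP[M aM] : jinvertible (g 1v).
  exact/h_inv/Omega_jinvertible.
have M0 : 0 < M by rewrite (le_lt_trans _ aM).
(* This scaling turns [|M 1 - a^2| < M], with [a = g 1], into [|1 - u^2| < 1], the convergence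
   condition of the iteration. *)
pose u := (Num.sqrt M)^-1 *: g 1v.
have sM0 : 0 < Num.sqrt M by rewrite sqrtr_gt0.
have sM : Num.sqrt M ^+ 2 = M by rewrite sqr_sqrtr // ltW.
have u1 : `|jev u (1 - 'X^2)| < 1.
  rewrite jevD jevN jev1 expr2 jevM jevX.
  have -> : 1v - u ** u = M^-1 *: (M *: 1v - g 1v ** g 1v).
    rewrite /u !jmulE; move: sM0 sM; set S := Num.sqrt M => S0 <-.
    by lin R; rewrite gt_eqF.
  by rewrite normrZ gtr0_norm ?invr_gt0 // mulrC ltr_pdivrMr // mul1r.
set P := 1 - 'X^2 in u1; pose v n := jev u ('X * newtonQ P n).
have Ov n : Omega V (h (v n)).
  elim: n => [|n IHn].
    rewrite /v mulr1 jevX /u (linear_scalef h_lin).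
    by apply: OmegaZ => //; rewrite invr_gt0.
  by apply: (Omega_of_ray_image IHn) => t t0; exact: newton_path.
set r := `|_| in u1; have r0 : 0 <= r by exact: normr_ge0.
have En n : `|jev u (newtonE P n)| <= r ^+ n.
  rewrite (le_trans (norm_newtonE n (ltW u1) (lexx _))) //.
  by rewrite exprS ler_piMl ?exprn_ge0 // ltW.
have vv n : v n ** v n = 1v - jev u (newtonE P n).
  rewrite -jevM -(jev1 u) -jevN -jevD -newtonQE; congr (jev u _).
  by rewrite /P; ring.
(* Consecutive iterates differ by half the product of an iterate, of norm at most 2, and the
   defect. *)
have [||s sP] := @geometric_limit R V v r; first by rewrite r0.
  move=> n; rewrite /v -jevN -jevD /=.
  have -> : 'X * (newtonQ P n * (1 + 2^-1 *: newtonE P n)) - 'X * newtonQ P n =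
      2^-1 *: ('X * newtonQ P n * newtonE P n).
    by rewrite mulrA mulrDr mulr1 -scalerAr addrAC subrr add0r.
  rewrite jevZ normrZ ger0_norm ?invr_ge0 // ler_pdivrMl //.
  by rewrite (le_trans (norm_jevM _ _ _)) // ler_pM // norm_newtonQ.
have ss : s ** s = 1v.
  apply/subr0_eq/eqP/negPn/negP => d_neq0.
  set d := s ** s - 1v in d_neq0; have d0 : 0 < `|d| by rewrite normr_gt0.
  (* With [v = v n] and [E] the defect, [d = (s - v) (2 s - (s - v)) - E]; if [s - v] and [E] have
     norm below [e <= 1], then [|d| < e (2 |s| + 2)]. *)
  pose e := Num.min 1 (`|d| / (2 * `|s| + 2)).
  have w0 : 0 < 2 * `|s| + 2 by rewrite ltr_wpDl // mulr_ge0.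
  have e0 : 0 < e by rewrite lt_min ltr01 divr_gt0.
  have [N NP] := sP e e0.
  have [||N' N'P] := @pow_small R r e; rewrite ?r0 //.
  pose n := maxn N N'; have sv := NP n (leq_maxl _ _).
  have Ee : `|jev u (newtonE P n)| < e.
    rewrite (le_lt_trans (En n)) // (le_lt_trans _ N'P) //.
    by rewrite ler_wiXn2l ?leq_maxr // ltW.
  have dE : d = (s - v n) ** (2 *: s - (s - v n)) - jev u (newtonE P n).
    have -> : jev u (newtonE P n) = 1v - v n ** v n by rewrite vv; lin R.
    by rewrite /d !jmulE (jmulC (v n) s); lin R.
  have e1 : e <= 1 by rewrite ge_min lexx.
  have : e * (2 * `|s| + 2) <= `|d|.
    by rewrite -ler_pdivlMr // ge_min lexx orbT.
  rewrite leNgt => /negP; apply; rewrite dE (le_lt_trans (ler_normB _ _)) //.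
  have m1 : `|2 *: s - (s - v n)| <= 2 * `|s| + 1.
    rewrite (le_trans (ler_normB _ _)) // normrZ ger0_norm // lerD2l.
    by rewrite ltW // (lt_le_trans sv).
  have m2 : `|(s - v n) ** (2 *: s - (s - v n))| <= e * (2 * `|s| + 1).
    by rewrite (le_trans (jb_normM _ _)) // ler_pM // ltW.
  by move: m2 Ee; rewrite !mulrDr !mulr1; lra.
(* [h s] is invertible because [s^2 = 1] is, and it is a limit of the points [h (v n)] of the
   cone. *)
exists s => //; apply: Omega_closed.
  apply/h_inv/jinvertible_sqr; rewrite ss; apply: Omega_jinvertible.
  by rewrite -[1v]scale1r; exact: Omega_scale1.
move=> e e0; have [_ [K hb]] := hGL.1.
have [|N NP] := sP (e / (`|K| + 1)); first by rewrite divr_gt0 // ltr_wpDl.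
rewrite (_ : h s + _ = h (v N) + (e *: 1v + h (s - v N))); last first.
  by rewrite (linear_subf h_lin); lin R.
apply: OmegaD => //; apply: Omega_unit_ball.
have := NP N (leqnn N); rewrite ltr_pdivlMr ?ltr_wpDl //; apply: le_lt_trans.
rewrite (le_trans (hb _)) // mulrC ler_wpM2l //.
by rewrite (le_trans (ler_norm _)) // lerDl.
Qed.

(* If s x = 0 then (x + t s)^2 = x^2 + t^2 is invertible for t > 0, so the line
   R x lies in the closure of the pointed cone h^-1(Omega). *)
Lemma symmetry_injective s x :
  s ** s = 1v -> Omega V (h s) -> s ** x = 0 -> x = 0.
Proof.
move=> ss Os; suff cl y e : 0 < e -> s ** y = 0 -> Omega V (h y + e *: 1v).
  move=> sx; rewrite -[LHS]hK (_ : h x = 0); last first.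
    apply: Omega_pointed => e e0; first exact: cl.
    by rewrite -(linear_oppf h_lin); apply: cl; rewrite // jmulNr sx oppr0.
  by apply: (can_inj hK); rewrite gK (linear_0f h_lin).
(* The size of [d] keeps [e 1 - d h(s)] in the cone; it remains to treat [h (y + d s)]. *)
move=> e0 sy; pose d := e / (`|h s| + 1).
have d0 : 0 < d by rewrite divr_gt0 // ltr_wpDl.
rewrite (_ : _ + _ = h (y + d *: s) + (e *: 1v + (- d) *: h s)); last first.
  by rewrite (linear_addf h_lin) (linear_scalef h_lin); lin R.
apply: OmegaD; last first.
  apply: Omega_unit_ball; rewrite normrZ normrN gtr0_norm //.
  by rewrite /d mulrAC ltr_pdivrMr ?ltr_wpDl // ltr_pM2l // ltrDl.
apply: (Omega_of_ray_image Os) => t t0; apply/jinvertible_sqr.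
have -> : (y + d *: s + t *: s) ** (y + d *: s + t *: s) =
    y ** y + (d + t) ^+ 2 *: 1v.
  rewrite (_ : y + d *: s + t *: s = y + (d + t) *: s); last by lin R.
  by rewrite !jmulE (jmulC y s) sy ss; lin R.
by apply/Omega_jinvertible/Omega_sqrD; rewrite exprn_gt0 // ltr_wpDr.
Qed.

End InvertibilityPreserving.

Definition central_symmetry s := s ** s = 1v /\ forall z w, z ** (s ** w) = s ** (z ** w).

Lemma symmetry_central s :
  s ** s = 1v -> (forall x, s ** x = 0 -> x = 0) -> central_symmetry s.
Proof.
move=> ss inj; have ssK w : s ** (s ** w) = w.
  apply/subr0_eq/inj; have := jL_cube s w; rewrite ss !jmulE => E.
  have -> : s ** (s ** (s ** w)) - s ** w =
      2^-1 *: (s ** w - (3 *: (s ** w) - 2 *: (s ** (s ** (s ** w))))) by lin R.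
  by rewrite -E subrr scaler0.
(* As [L_s] is an involution, [z = s y]; the polarised identity at [s, s, y, w] then reads [y w + 2
   (s y) (s w) = 2 s ((s y) w) + y w]. *)
split=> // z w; set y := s ** z; have -> : z = s ** y by rewrite /y ssK.
have := jordan_polarized s s y w; rewrite ss !jmulE (jmulC y s) => E.
apply/subr0_eq.
have -> : (s ** y) ** (s ** w) - s ** ((s ** y) ** w) =
  2^-1 *: ((y ** w + (s ** y) ** (s ** w) + (s ** y) ** (s ** w))
   - (s ** ((s ** y) ** w) + s ** ((s ** y) ** w) + y ** w)) by lin R.
by rewrite E subrr scaler0.
Qed.

Section CentralSymmetry.
Variables (s : V) (s_cs : central_symmetry s).
Let ss := s_cs.1.

Lemma csymC z w : z ** (s ** w) = s ** (z ** w).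
Proof. exact: s_cs.2. Qed.
Lemma csymA y w : (s ** y) ** w = s ** (y ** w).
Proof. by rewrite jmulC csymC (jmulC w). Qed.
Lemma csymK w : s ** (s ** w) = w.
Proof. by rewrite -csymA ss jmul1. Qed.

Lemma jU_csym y : jU (s ** y) = jU y.
Proof. by apply/funext => w; rewrite /jU /jL !(csymA, csymC) !csymK. Qed.

Lemma jinvertible_csym y : jinvertible (s ** y) <-> jinvertible y.
Proof. by rewrite /jinvertible jU_csym. Qed.

Lemma GL_csym : GL V (jL s).
Proof.
have bnd : bounded_operator (jL s).
  by split; [exact: jmul_linear | exists `|s| => x; exact: jb_normM].
by split=> //; exists (jL s); split=> //; exact: csymK.
Qed.

Lemma Str_csym : Str V (jL s).
Proof.
split; first exact: GL_csym.
exists (jL s); first exact: GL_csym.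
move=> x; apply/funext => w; rewrite /= /jL jU_csym.
by rewrite /jU /jL !csymC !(jmulDr, jmulNr, jmulZr) !csymK.
Qed.

(** Since [s y + t 1 = s (y + t s)] and [L_s] preserves invertibility, the ray from [y] in direction
    [s] and the ray from [s y] in direction 1 consist of invertible elements simultaneously. *)
Lemma Omega_csym h : GL V h -> (forall y, jinvertible (h y) <-> jinvertible y) ->
  Omega V (h s) -> forall y, Omega V (h y) <-> Omega V (s ** y).
Proof.
move=> hGL h_inv Os y; split=> Oy.
  apply/OmegaP => t t0; have -> : s ** y + t *: 1v = s ** (y + t *: s).
    by rewrite !jmulE ss.
  apply/jinvertible_csym/h_inv/Omega_jinvertible.
  rewrite (linear_addf hGL.1.1) (linear_scalef hGL.1.1).
  move: t0; rewrite le_eqVlt => /predU1P[<-|t0]; first by rewrite scale0r addr0.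
  exact/OmegaD/OmegaZ.
apply: (Omega_of_ray_image hGL h_inv Os) => t t0.
apply/jinvertible_csym; rewrite !jmulE ss.
by move/OmegaP: Oy; apply.
Qed.

End CentralSymmetry.

Lemma csym_of_projection p :
  central_projection V p -> central_symmetry (2 *: p - 1v) /\ jS p = jL (2 *: p - 1v).
Proof.
move=> [pp pc]; split; last by apply/funext => x; rewrite /jS /jL !jmulE.
split=> [|z w]; first by rewrite !jmulE pp; lin R.
have pzw : p ** (z ** w) = z ** (p ** w) by have /(congr1 (@^~ w)) := pc z.
by rewrite !jmulE pzw.
Qed.

Lemma projection_of_csym s : central_symmetry s ->
  central_projection V (2^-1 *: (1v + s)) /\ jS (2^-1 *: (1v + s)) = jL s.
Proof.
move=> [ss sC]; split.
  split; first by rewrite !jmulE ss; lin R.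
  by move=> z; apply/funext => w; rewrite /jL /= !jmulE sC.
by apply/funext => x; rewrite /jS /jL !jmulE; lin R.
Qed.

(** [U_{x+1} (x - 1) = (x + 1) (x^2 - 1) = 0], and [U_{x+1}] is injective because [x + 1] lies in
    the cone. *)
Lemma Omega_sqr1 x : Omega V x -> x ** x = 1v -> x = 1v.
Proof.
move=> Ox xx; have [_ [k [_ kK _]]] : jinvertible (x + 1v).
  by apply: Omega_jinvertible; rewrite -[1v]scale1r; apply: OmegaD => //; exact: Omega_scale1.
apply/subr0_eq/(can_inj kK); rewrite (linear_0f (jU_linear _)).
by rewrite /jU /jL !jmulE xx !jmulE; lin R.
Qed.

Lemma GOmegaP f :
  GOmega V f <-> GL V f /\ forall x, Omega V (f x) <-> Omega V x.
Proof.
split=> [[fGL fO]|[fGL fO]]; split=> //.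
  have [_ [k [_ fK _]]] := fGL.
  move=> x; split=> [Ofx|Ox]; last by rewrite -fO; exists x.
  by move: Ofx; rewrite -{1}fO => -[y Oy /(can_inj fK) <-].
have [_ [k [_ _ kK]]] := fGL.
apply/seteqP; split=> [_ [x Ox <-]|x Ox]; first exact/fO.
by exists (k x); rewrite ?kK //; apply/fO; rewrite kK.
Qed.

Lemma Str_jinvertible g x : Str V g -> jinvertible (g x) <-> jinvertible x.
Proof.
move=> [gGL [gs gsGL gU]]; rewrite /jinvertible gU; split=> [inv|inv]; last first.
  by do 2 apply: GL_comp => //.
have [k [kGL gK kK]] := GL_inv gGL; have [l [lGL gsK lK]] := GL_inv gsGL.
rewrite (_ : jU x = k \o (g \o jU x \o gs) \o l); first by do 2 apply: GL_comp => //.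
by apply/funext => w; rewrite /= gK lK.
Qed.

Lemma Str_csym_factor g : Str V g ->
  exists2 s, central_symmetry s & coset_GOmega (jL s) = coset_GOmega g.
Proof.
move=> gS; have gGL := gS.1; have [h [hGL gK hK]] := GL_inv gGL.
have h_inv y : jinvertible (h y) <-> jinvertible y.
  by rewrite -{2}(hK y); split=> /(Str_jinvertible _ gS).
have [s ss Os] := exists_symmetry hGL gK h_inv.
have s_cs : central_symmetry s.
  by apply: symmetry_central => // x; exact: (symmetry_injective hGL gK hK h_inv ss Os).
have hs := Omega_csym s_cs hGL h_inv Os.
(* [L_s k = g (h L_s k)] and [g k = L_s (L_s g k)]; by [hs], both [h L_s] and [L_s g] preserve the
   cone. *)
exists s => //; apply/seteqP; split=> _ [k /GOmegaP[kGL kO] <-].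
  exists (h \o jL s \o k).
    apply/GOmegaP; split=> [|x]; last by rewrite /= hs /jL csymK.
    by do 2 apply: GL_comp => //; exact: GL_csym.
  by apply/funext => x /=; rewrite hK.
exists (jL s \o g \o k).
  apply/GOmegaP; split=> [|x]; last by rewrite /= /jL -hs gK.
  by do 2 apply: GL_comp => //; exact: GL_csym.
by apply/funext => x /=; rewrite /jL csymK.
Qed.

(** If [L_s k = L_s' k'], evaluation at the preimage of 1 under [k'] puts [s s'] into the cone; its
    square is 1, so [Omega_sqr1] gives [s s' = 1]. *)
Lemma csym_coset_inj s s' f : central_symmetry s -> central_symmetry s' ->
  coset_GOmega (jL s) f -> coset_GOmega (jL s') f -> s = s'.
Proof.
move=> cs cs' [k /GOmegaP[_ kO] kE] [k' /GOmegaP[k'GL k'O] k'E].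
have [_ [l [_ _ lK]]] := k'GL.
have O1 : Omega V 1v by rewrite -[1v]scale1r; exact: Omega_scale1.
have Oss : Omega V (s ** s').
  have -> : s ** s' = k (l 1v).
    have : (jL s' \o k') (l 1v) = (jL s \o k) (l 1v) by rewrite kE k'E.
    by rewrite /= lK /jL jmulr1 => ->; rewrite csymK.
  by apply/kO; apply/k'O; rewrite lK.
have /(congr1 (jmul s)) : s ** s' = 1v.
  by apply: Omega_sqr1; rewrite // !csymA // csymC // csymK // cs'.1.
by rewrite csymK // jmulr1.
Qed.

End CentralSymmetries.

Theorem corollary3p40 (R : realType) (V : jbAlgType R) :
  set_bij (central_projection V) (Str_cosets V)
    (fun p => coset_GOmega (jS p)) /\
  trivIset (central_projection V) (fun p => coset_GOmega (jS p)).
Proof.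
have triv : trivIset (central_projection V) (fun p => coset_GOmega (jS p)).
  move=> p q /csym_of_projection[p_cs ->] /csym_of_projection[q_cs ->] [f [fp fq]].
  have /addIr/(congr1 ( *:%R 2^-1)) := csym_coset_inj p_cs q_cs fp fq.
  by rewrite !scalerA mulVf // !scale1r.
split=> //; split.
- move=> p /csym_of_projection[p_cs ->].
  by exists (jL (2 *: p - jone)) => //; exact: Str_csym.
(* Each coset contains its representative, so equal cosets meet and disjointness yields
   injectivity. *)
- move=> p q /set_mem p_cp /set_mem q_cp pq; apply: (triv _ _ p_cp q_cp).
  rewrite -pq setIid; exists (jS p), id => //.
  by apply/GOmegaP; split=> //; exact: GL_id.
move=> _ [g /Str_csym_factor[s s_cs <-] <-].
have [p_cp pE] := projection_of_csym s_cs.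
by exists (2^-1 *: (jone + s)) => //; rewrite pE.
Qed.
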